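(* If $r=D+C^T(J-L_A(x))^{-1}C$ is a minimal symmetric descriptor realization with $r(0)=D+C^TJC\succ 0$, then $r$ has no well hidden singularities.
   Context: Fix a positive integer $g$. $\mathbb{S}_n(\mathbb{R}^g)$ is the set of $g$-tuples $X=(X_1,\dots,X_g)$ of real symmetric $n\times n$ matrices. For a symmetric matrix $Y$, $Y\succ 0$ means positive definite. For $A=(A_1,\dots,A_g)\in\mathbb{S}_d(\mathbb{R}^g)$, $L_A(x)=\sum_{j=1}^g A_jx_j$, where $x=(x_1,\dots,x_g)$ are freely noncommuting variables, evaluated at $X\in\mathbb{S}_n(\mathbb{R}^g)$ by $L_A(X)=\sum_j A_j\otimes X_j$ (Kronecker product). For a $d\times d$ matrix $J$, $J-L_A(X)$ means $J\otimes I_n-L_A(X)$. Symmetric descriptor realization: an expression $r=D+C^T(J-L_A(x))^{-1}C$, where $J$ is a $d\times d$ real matrix with $J=J^T$, $J^2=I$, $A\in\mathbb{S}_d(\mathbb{R}^g)$, $C$ is a real $d\times\ell$ matrix and $D$ is a real $\ell\times\ell$ matrix. Its invertibility set is $\mathfrak{I}_{J-L_A(x)}(n)=\{X\in\mathbb{S}_n(\mathbb{R}^g): J-L_A(X)\text{ is invertible}\}$ (open and dense in $\mathbb{S}_n(\mathbb{R}^g)$), and for $X$ in this set $r(X)=D\otimes I_n+(C^T\otimes I_n)(J-L_A(X))^{-1}(C\otimes I_n)$. The realization is minimal if $\{(JA)^wJC\mathtt{h}: w\text{ a word},\ \mathtt{h}\in\mathbb{R}^\ell\}$ spans $\mathbb{R}^d$;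 here words are elements of the free semigroup with identity on $x_1,\dots,x_g$, $JA=(JA_1,\dots,JA_g)$, and for a word $w=x_{i_1}\cdots x_{i_k}$ and a tuple $M$, $M^w=M_{i_1}\cdots M_{i_k}$ (identity for the empty word). $\chi\in\mathbb{S}_n(\mathbb{R}^g)\setminus\mathfrak{I}_{J-L_A(x)}(n)$ is a hidden singularity of $r$ if $\lim_{X\to\chi}r(X)$ exists, the limit being taken through $X\in\mathfrak{I}_{J-L_A(x)}(n)$. A hidden singularity $\chi\in\mathbb{S}_n(\mathbb{R}^g)$ of $r$ is well hidden if for each positive integer $m$ and each $K\in\mathbb{S}_m(\mathbb{R}^g)$ there is a $\rho_0>0$ such that, for all real $\rho$ with $|\rho|<\rho_0$, the tuple $\chi\oplus\rho K\in\mathbb{S}_{n+m}(\mathbb{R}^g)$, with entries $\begin{pmatrix}\chi_j&0\\0&\rho K_j\end{pmatrix}$, is also a hidden singularity of $r$. *)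

(* Defs.v *)
From HB Require Import structures.
From mathcomp Require Import all_boot all_order all_algebra.
From mathcomp Require Import mxtens.
From mathcomp Require Import all_classical all_reals all_analysis.

Set Implicit Arguments.
Unset Strict Implicit.
Unset Printing Implicit Defensive.

Import Order.TTheory GRing.Theory Num.Theory.
Import numFieldNormedType.Exports.

Local Open Scope classical_set_scope.
Local Open Scope ring_scope.

Definition sym_tuple (R : realType) (g n : nat) (X : 'I_g -> 'M[R]_n) : Prop :=
  forall j, (X j)^T = X j.

(* Positive definiteness is a notion for symmetric matrices only, so symmetry
   is part of it. *)
Definition posdef (R : realType) (n : nat) (Y : 'M[R]_n) : Prop :=
  Y^T = Y /\ forall v : 'cV[R]_n, v != 0 -> 0 < (v^T *m Y *m v) 0 0.

(* The data of r = D + C^T (J - L_A(x))^-1 C; D is not assumed symmetric. *)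
Record sym_descriptor (R : realType) (g d l : nat) := SymDescriptor {
  sd_J : 'M[R]_d;
  sd_A : 'I_g -> 'M[R]_d;
  sd_C : 'M[R]_(d, l);
  sd_D : 'M[R]_l;
  sd_J_sym : sd_J^T = sd_J;
  sd_J_invol : sd_J *m sd_J = 1%:M;
  sd_A_sym : sym_tuple sd_A
}.

Definition lin_pencil (R : realType) (g d n : nat)
    (A : 'I_g -> 'M[R]_d) (X : 'I_g -> 'M[R]_n) : 'M[R]_(d * n) :=
  \sum_(j < g) A j *t X j.

Definition sd_pencil (R : realType) (g d l n : nat)
    (r : sym_descriptor R g d l) (X : 'I_g -> 'M[R]_n) : 'M[R]_(d * n) :=
  sd_J r *t 1%:M - lin_pencil (sd_A r) X.

Definition invertibility_set (R : realType) (g d l : nat)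
    (r : sym_descriptor R g d l) (n : nat) : set ('I_g -> 'M[R]_n) :=
  [set X | sym_tuple X /\ sd_pencil r X \in unitmx].

(* r(X), meaningful only for X in the invertibility set. *)
Definition sd_eval (R : realType) (g d l : nat)
    (r : sym_descriptor R g d l) (n : nat) (X : 'I_g -> 'M[R]_n) :
    'M[R]_(l * n) :=
  sd_D r *t 1%:M
    + ((sd_C r)^T *t 1%:M) *m invmx (sd_pencil r X) *m (sd_C r *t 1%:M).

Definition word_mx (R : realType) (g d : nat) (M : 'I_g -> 'M[R]_d)
    (w : seq 'I_g) : 'M[R]_d :=
  \big[mulmx/1%:M]_(i <- w) M i.

(* The vectors (JA)^w J C h span R^d: each v lies in the span of finitely many
   of them. *)
Definition minimal (R : realType) (g d l : nat)
    (r : sym_descriptor R g d l) : Prop :=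
  forall v : 'cV[R]_d, exists s : seq (seq 'I_g * 'cV[R]_l),
    v \in <<[seq word_mx (fun j => sd_J r *m sd_A r j) p.1
                  *m sd_J r *m sd_C r *m p.2 | p <- s]>>%VS.

(* The tuples carry the product topology. *)
Definition hidden_singularity (R : realType) (g d l : nat)
    (r : sym_descriptor R g d l) (n : nat) (chi : 'I_g -> 'M[R]_n) : Prop :=
  [/\ sym_tuple chi,
      ~ invertibility_set r chi &
      exists L : 'M[R]_(l * n),
        @sd_eval R g d l r n X
          @[X --> within (invertibility_set r (n := n))
                    (nbhs (chi : {ptws 'I_g -> 'M[R]_n}))] --> L].

Definition dsum_tuple (R : realType) (g n m : nat)
    (X : 'I_g -> 'M[R]_n) (Y : 'I_g -> 'M[R]_m) : 'I_g -> 'M[R]_(n + m) :=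
  fun j => block_mx (X j) 0 0 (Y j).

Definition well_hidden (R : realType) (g d l : nat)
    (r : sym_descriptor R g d l) (n : nat) (chi : 'I_g -> 'M[R]_n) : Prop :=
  hidden_singularity r chi /\
  forall (m : nat) (K : 'I_g -> 'M[R]_m), (0 < m)%N -> sym_tuple K ->
    exists2 rho0 : R, 0 < rho0 &
      forall rho : R, `|rho| < rho0 ->
        hidden_singularity r (dsum_tuple chi (fun j => rho *: K j)).

(* Main.v *)
From HB Require Import structures.
Require Import Defs.
From mathcomp Require Import all_boot all_order all_algebra.
From mathcomp Require Import mxtens.
From mathcomp Require Import all_classical all_reals all_analysis.
From mathcomp Require Import ring.
Set Implicit Arguments.
Unset Strict Implicit.
Unset Printing Implicit Defensive.
Import Order.TTheory GRing.Theory Num.Theory.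
Import numFieldNormedType.Exports.
Local Open Scope ring_scope.

(* Identify R^d (x) R^n with d x n matrices, so that the pencil at X becomes
   the operator Y |-> J Y - sum_j A_j Y X_j.  A singularity chi gives V <> 0
   with J V = sum_j A_j V chi_j.  Couple (1 - eps) chi to a small tuple K by
   off-diagonal blocks s H_j, with 0 < eps < s^2.  If minimality makes (K, H)
   rich enough, the pencil at the coupled tuple sends (V / s, Z) to (0, C c),
   where Z and c depend affinely on eps / s^2 and hence stay bounded.  Compared
   with the uncoupled tuple (s = 0), the value of r at (0, c) changes in its
   second block by a matrix T independent of s and eps.  Existence of the limit
   at chi (+) K forces T = 0, whereas T = 0 would give, by duality, A_j V = 0
   for every j, so J V = 0 and V = 0. *)

(** * Invertibility along one-parameter families of linear maps *)

Lemma unitmx_inj (F : fieldType) k (A : 'M[F]_k) :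
  (forall v : 'cV[F]_k, A *m v = 0 -> v = 0) -> A \in unitmx.
Proof.
move=> Ainj; rewrite -unitmx_tr unitmxE unitfE; apply/negP => /det0P[v v0 vA].
by case/eqP: v0; apply: trmx_inj; rewrite trmx0; apply: Ainj;
  rewrite -[A]trmxK -trmx_mul vA trmx0.
Qed.

Lemma det_pencil_horner (F : comNzRingType) k (A B : 'M[F]_k) :
  exists p : {poly F}, forall t, p.[t] = \det (A + t *: B).
Proof.
exists (\det (map_mx polyC A + 'X *: map_mx polyC B)) => t.
rewrite -horner_evalE -det_map_mx; congr (\det _); apply/matrixP => i j.
by rewrite !mxE /= horner_evalE !hornerE.
Qed.

(** Here [p] is the determinant of the operator in [mxvec] coordinates, so regularity at one
    parameter persists at all but finitely many others. *)
Lemma linear_pencil_bij (F : fieldType) a b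
    (f0 f1 : {linear 'M[F]_(a, b) -> 'M[F]_(a, b)}) t0 :
    (forall Y, f0 Y + t0 *: f1 Y = 0 -> Y = 0) ->
  exists p : {poly F}, p.[t0] != 0 /\
    forall t, p.[t] != 0 -> bijective (fun Y => f0 Y + t *: f1 Y).
Proof.
move=> inj0; have [p pE] := det_pencil_horner (lin_mx f0) (lin_mx f1).
have actE t Y : mxvec Y *m (lin_mx f0 + t *: lin_mx f1) =
    mxvec (f0 Y + t *: f1 Y).
  by rewrite mulmxDr -scalemxAr !mul_vec_lin linearD linearZ.
exists p; split=> [|t pt].
  rewrite pE; apply/det0P => -[v v0 vA]; case/eqP: v0.
  rewrite -[v]vec_mxK; apply/eqP; rewrite mxvec_eq0; apply/eqP/inj0.
  by apply/eqP; rewrite -mxvec_eq0 -actE vec_mxK vA.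
have Mu : lin_mx f0 + t *: lin_mx f1 \in unitmx by rewrite unitmxE unitfE -pE.
exists (fun Z => vec_mx (mxvec Z *m invmx (lin_mx f0 + t *: lin_mx f1))) => Y.
  by rewrite -actE mulmxK ?mxvecK.
by apply: (can_inj mxvecK); rewrite -actE vec_mxK mulmxKV.
Qed.

(** A nonzero [p] has fewer than [size p] roots, so that many distinct candidates suffice. Their
    denominators start at 2 to keep them strictly below [e]. *)
Lemma exists_small_nonroot (F : realFieldType) (p : {poly F}) (e : F) :
  p != 0 -> 0 < e -> exists t, [/\ 0 < t, t < e & p.[t] != 0].
Proof.
move=> p0 e0; apply: contrapT => none.
pose rs := [seq e / k.+2%:R | k <- iota 0 (size p)].
suff : (size rs < size p)%N by rewrite size_map size_iota ltnn.
apply: max_poly_roots => //.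
  apply/allP => _ /mapP[k _ ->]; apply: contrapT => /negP nr.
  apply: none; exists (e / k.+2%:R); split=> //; first exact: divr_gt0.
  by rewrite ltr_pdivrMr ?ltr0n// ltr_pMr// ltr1n.
rewrite map_inj_uniq ?iota_uniq// => i j /(mulfI (lt0r_neq0 e0)) /invr_inj /eqP.
by rewrite eqr_nat => /eqP[].
Qed.

(** * The pencil as a sum of two-sided multiplications *)

Section Sylv.
Context {F : fieldType} {g : nat}.

Definition coef_act d n (A : 'I_g -> 'M[F]_d) p (X : 'I_g -> 'M[F]_(n, p))
  (Y : 'M[F]_(d, n)) : 'M[F]_(d, p) := \sum_j A j *m Y *m X j.

Definition sylv d n (J : 'M[F]_d) (A : 'I_g -> 'M[F]_d) (X : 'I_g -> 'M[F]_n)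
  (Y : 'M[F]_(d, n)) : 'M[F]_(d, n) := J *m Y - coef_act A X Y.

Fact coef_act_is_linear d n A p X : linear (@coef_act d n A p X).
Proof.
move=> a Y Z; rewrite /coef_act scaler_sumr -big_split /=.
by apply: eq_bigr => j _; rewrite mulmxDr mulmxDl -scalemxAr -scalemxAl.
Qed.
HB.instance Definition _ d n A p X :=
  GRing.isLinear.Build F _ _ _ (@coef_act d n A p X)
    (@coef_act_is_linear d n A p X).

Fact sylv_is_linear d n J A X : linear (@sylv d n J A X).
Proof.
move=> a Y Z; rewrite /sylv !linearP /=.
by rewrite scalerDr addrACA.
Qed.
HB.instance Definition _ d n J A X :=
  GRing.isLinear.Build F _ _ _ (@sylv d n J A X) (@sylv_is_linear d n J A X).

Lemma coef_actDr d n A p (X X' : 'I_g -> 'M[F]_(n, p)) (Y : 'M[F]_(d, n)) :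
  coef_act A (fun j => X j + X' j) Y = coef_act A X Y + coef_act A X' Y.
Proof. by rewrite -big_split; apply: eq_bigr => j _; rewrite mulmxDr. Qed.

Lemma coef_actZr d n A p a (X : 'I_g -> 'M[F]_(n, p)) (Y : 'M[F]_(d, n)) :
  coef_act A (fun j => a *: X j) Y = a *: coef_act A X Y.
Proof. by rewrite scaler_sumr; apply: eq_bigr => j _; rewrite scalemxAr. Qed.

Lemma coef_act_mulr d n A p q (X : 'I_g -> 'M[F]_(n, p)) (Y : 'M[F]_(d, n))
    (B : 'M[F]_(p, q)) :
  coef_act A X Y *m B = coef_act A (fun j => X j *m B) Y.
Proof. by rewrite mulmx_suml; apply: eq_bigr => j _; rewrite !mulmxA. Qed.

Lemma coef_act_mull d n A p q (X : 'I_g -> 'M[F]_(n, p)) (Y : 'M[F]_(d, q))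
    (B : 'M[F]_(q, n)) :
  coef_act A X (Y *m B) = coef_act A (fun j => B *m X j) Y.
Proof. by apply: eq_bigr => j _; rewrite !mulmxA. Qed.

Lemma eq_coef_act d n A p (X X' : 'I_g -> 'M[F]_(n, p)) (Y : 'M[F]_(d, n)) :
  X =1 X' -> coef_act A X Y = coef_act A X' Y.
Proof. by move=> eqX; apply: eq_bigr => j _; rewrite eqX. Qed.

Lemma coef_act_block d n p n' p' A
    (X11 : 'I_g -> 'M[F]_(n, n')) (X12 : 'I_g -> 'M[F]_(n, p'))
    (X21 : 'I_g -> 'M[F]_(p, n')) (X22 : 'I_g -> 'M[F]_(p, p'))
    (Y1 : 'M[F]_(d, n)) (Y2 : 'M[F]_(d, p)) :
  coef_act A (fun j => block_mx (X11 j) (X12 j) (X21 j) (X22 j))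
    (row_mx Y1 Y2) =
  row_mx (coef_act A X11 Y1 + coef_act A X21 Y2)
         (coef_act A X12 Y1 + coef_act A X22 Y2).
Proof.
rewrite /coef_act -!big_split /=.
elim/big_rec3: _ => [|j y1 y2 _ _ ->]; first by rewrite row_mx0.
by rewrite mul_mx_row mul_row_block add_row_mx.
Qed.

Lemma sylv_block d n p J A
    (X11 : 'I_g -> 'M[F]_n) (X12 : 'I_g -> 'M[F]_(n, p))
    (X21 : 'I_g -> 'M[F]_(p, n)) (X22 : 'I_g -> 'M[F]_p)
    (Y1 : 'M[F]_(d, n)) (Y2 : 'M[F]_(d, p)) :
  sylv J A (fun j => block_mx (X11 j) (X12 j) (X21 j) (X22 j)) (row_mx Y1 Y2) =
  row_mx (sylv J A X11 Y1 - coef_act A X21 Y2)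
         (sylv J A X22 Y2 - coef_act A X12 Y1).
Proof.
rewrite /sylv coef_act_block mul_mx_row opp_row_mx add_row_mx !opprD !addrA.
by congr row_mx; rewrite addrAC.
Qed.

Lemma eq_sylv d n J A (X X' : 'I_g -> 'M[F]_n) (Y : 'M[F]_(d, n)) :
  X =1 X' -> sylv J A X Y = sylv J A X' Y.
Proof. by move=> eqX; rewrite /sylv (eq_coef_act _ _ eqX). Qed.

Lemma sylv_affine d n J A t (X X' : 'I_g -> 'M[F]_n) (Y : 'M[F]_(d, n)) :
  sylv J A (fun j => X j + t *: X' j) Y =
  sylv J A X Y + t *: (- coef_act A X' Y).
Proof. by rewrite /sylv coef_actDr coef_actZr opprD addrA scalerN. Qed.

Lemma sylv_pencil_bij d n J A t0 (X X' : 'I_g -> 'M[F]_n) :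
    (forall Y : 'M[F]_(d, n),
       sylv J A (fun j => X j + t0 *: X' j) Y = 0 -> Y = 0) ->
  exists p : {poly F}, p.[t0] != 0 /\
    forall t, p.[t] != 0 ->
      bijective (@sylv d n J A (fun j => X j + t *: X' j)).
Proof.
move=> inj0; have [Y|p [pt0 pP]] :=
    @linear_pencil_bij _ _ _ (@sylv d n J A X) (-%R \o coef_act A X') t0.
  by rewrite -sylv_affine; exact: inj0.
exists p; split=> // t /pP[G GK KG]; exists G => Y.
  by rewrite sylv_affine; exact: GK.
by rewrite sylv_affine; exact: KG.
Qed.

(** With symmetric coefficients every term [A j *m Y *m X j] is self-adjoint for the trace
    pairing. *)
Lemma mxtrace_sylv d n J A (X : 'I_g -> 'M[F]_n) (Y Z : 'M[F]_(d, n)) :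
    J^T = J -> (forall j, (A j)^T = A j) -> (forall j, (X j)^T = X j) ->
  \tr (Y^T *m sylv J A X Z) = \tr ((sylv J A X Y)^T *m Z).
Proof.
move=> Js As Xs; rewrite /sylv mulmxBr linearB [in RHS]linearB /= mulmxBl.
rewrite [in RHS]linearB /= trmx_mul Js mulmxA; congr (_ - _).
rewrite mulmx_sumr !linear_sum mulmx_suml linear_sum; apply: eq_bigr => j _ /=.
by rewrite mulmxA mxtrace_mulC !trmx_mul As Xs !mulmxA.
Qed.

End Sylv.

(** * Interpolation models built from minimality *)

Section Reachability.
Context {F : fieldType} {g d l : nat}.
Variables (J : 'M[F]_d) (A : 'I_g -> 'M[F]_d) (C : 'M[F]_(d, l)).
Hypothesis Jinvol : J *m J = 1%:M.

(* A nilpotent tuple S (paths spelling words) produces exact products of the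
   J A_j, but only symmetric tuples are admissible.  The matrices D conjugate
   rho (S_j + S_j^T) into S_j + rho^2 S_j^T, so that S is the limit of small
   symmetric tuples as rho tends to 0. *)
Definition reaches q (W : set 'M[F]_(d, q)) : Prop :=
  exists m (S : 'I_g -> 'M[F]_m) (e : 'M[F]_(m, q)),
  [/\ forall Z : 'M[F]_(d, m), sylv J A S Z = 0 -> Z = 0,
      forall rho, rho != 0 -> exists D : 'M[F]_m,
        [/\ D^T = D, D *m e = e & forall j, S j *m D = rho *: (D *m S j)] &
      forall u, W u -> exists Z c, sylv J A S Z = C *m c /\ Z *m e = u].

Lemma coef_act0 n p (Y : 'M[F]_(d, n)) :
  coef_act A (fun=> 0 : 'M[F]_(n, p)) Y = 0.
Proof. by rewrite /coef_act big1 // => j _; rewrite mulmx0. Qed.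

Lemma coef_act_single n p j (e : 'M[F]_(n, p)) (Y : 'M[F]_(d, n)) :
  coef_act A (fun i => if i == j then e else 0) Y = A j *m Y *m e.
Proof.
rewrite /coef_act (bigD1 j) //= eqxx big1 ?addr0 // => i /negPf ->.
by rewrite mulmx0.
Qed.

Lemma sylv0 n (Y : 'M[F]_(d, n)) : sylv J A (fun=> 0) Y = J *m Y.
Proof. by rewrite /sylv coef_act0 subr0. Qed.

Lemma invol_mulK n (Y : 'M[F]_(d, n)) : J *m (J *m Y) = Y.
Proof. by rewrite mulmxA Jinvol mul1mx. Qed.

Lemma invol_inj n (Y : 'M[F]_(d, n)) : J *m Y = 0 -> Y = 0.
Proof. by move=> JY; rewrite -[Y]invol_mulK JY mulmx0. Qed.

Lemma reaches_subset q (W W' : set 'M[F]_(d, q)) :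
  (W' `<=` W)%classic -> reaches W -> reaches W'.
Proof.
by move=> sub [m [S [e [inj0 scale sol]]]]; exists m, S, e; split=> // u /sub/sol.
Qed.

(** At the zero tuple of size 1 the operator is multiplication by the involution [J], which sends
    [J C h] to [C h]. *)
Lemma reaches_base (h : 'cV[F]_l) : reaches [set J *m C *m h]%classic.
Proof.
exists 1%N, (fun=> 0), 1%:M; split=> [Z | rho _ | _ ->].
- by rewrite sylv0 => /invol_inj.
- exists 1%:M; split; rewrite ?trmx1 ?mulmx1 // => j.
  by rewrite mulmx0 scaler0.
- exists (J *m C *m h), h; rewrite mulmx1; split=> //.
  by rewrite sylv0 -mulmxA invol_mulK.
Qed.

(** The [q] new coordinates prolong paths by the letter [j]: the block [e] feeds [Z e = w] into
    them, where the equation [J Z1 = A_j w] has the solution [J A_j w]. *)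
Lemma reaches_mulJA q j (W : set 'M[F]_(d, q)) :
  reaches W -> reaches [set J *m A j *m w | w in W]%classic.
Proof.
move=> [m [S [e [inj0 scale sol]]]].
exists (q + m)%N, (fun i => block_mx 0 0 (if i == j then e else 0) (S i)),
  (col_mx 1%:M 0); split=> [Z | rho rho0 | _ [w Ww <-]].
- rewrite -[Z]hsubmxK sylv_block coef_act0 coef_act_single subr0 sylv0.
  rewrite -[0]row_mx0 => /eq_row_mx[Z1 /inj0 Z2].
  move: Z1; rewrite Z2 mulmx0 mul0mx subr0 => /invol_inj ->.
  by rewrite row_mx0.
- have [D [Ds De SD]] := scale _ rho0.
  (* The old coordinates lie one level away from the new ones; since [D e = e], the factor [rho^-1]
     makes the connecting block scale by [rho] too. *)
  exists (block_mx 1%:M 0 0 (rho^-1 *: D)); split.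
  + by rewrite tr_block_mx !trmx0 trmx1 linearZ /= Ds.
  + by rewrite mul_block_col !mulmx0 mul0mx mulmx1 !addr0.
  + move=> i; rewrite !mulmx_block !mul0mx !mulmx0 !mulmx1 !addr0 !add0r.
    rewrite scale_block_mx !scaler0 -scalemxAr SD -!scalemxAl !scalerA.
    rewrite mulVf // mulfV // !scale1r; congr block_mx.
    by case: ifP => _; rewrite ?De ?mulmx0.
- have [Z [c [SZ Ze]]] := sol _ Ww.
  exists (row_mx (J *m A j *m w) Z), (row_mx 0 c); split; last first.
    by rewrite mul_row_col mulmx1 mulmx0 addr0.
  rewrite sylv_block coef_act0 coef_act_single subr0 sylv0 SZ.
  by rewrite -mulmxA invol_mulK -[A j *m Z *m e]mulmxA Ze subrr mul_mx_row mulmx0.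
Qed.

Lemma reaches_mulr q q' (B : 'M[F]_(q, q')) (W : set 'M[F]_(d, q)) :
  reaches W -> reaches [set w *m B | w in W]%classic.
Proof.
move=> [m [S [e [inj0 scale sol]]]]; exists m, S, (e *m B); split=> //.
  move=> rho /scale[D [Ds De SD]]; exists D; split=> //.
  by rewrite mulmxA De.
move=> _ [w /sol[Z [c [SZ Ze]]] <-]; exists Z, c; split=> //.
by rewrite mulmxA Ze.
Qed.

Lemma reaches_row_mx q1 q2 (W1 : set 'M[F]_(d, q1)) (W2 : set 'M[F]_(d, q2)) :
  reaches W1 -> reaches W2 ->
  reaches [set row_mx w1 w2 | w1 in W1 & w2 in W2]%classic.
Proof.
move=> [m1 [S1 [e1 [inj1 scale1 sol1]]]] [m2 [S2 [e2 [inj2 scale2 sol2]]]].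
exists (m1 + m2)%N, (fun i => block_mx (S1 i) 0 0 (S2 i)), (block_mx e1 0 0 e2).
split=> [Z | rho rho0 | _ [w1 Ww1 [w2 Ww2 <-]]].
- rewrite -[Z]hsubmxK sylv_block !coef_act0 !subr0.
  by rewrite -[0]row_mx0 => /eq_row_mx[/inj1 -> /inj2 ->].
- have [D1 [Ds1 De1 SD1]] := scale1 _ rho0.
  have [D2 [Ds2 De2 SD2]] := scale2 _ rho0.
  exists (block_mx D1 0 0 D2); split.
  + by rewrite tr_block_mx !trmx0 Ds1 Ds2.
  + by rewrite mulmx_block !mulmx0 !mul0mx !addr0 !add0r De1 De2.
  + move=> i; rewrite !mulmx_block !mulmx0 !mul0mx !addr0 !add0r.
    by rewrite scale_block_mx !scaler0 SD1 SD2.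
- have [Z1 [c1 [SZ1 Ze1]]] := sol1 _ Ww1.
  have [Z2 [c2 [SZ2 Ze2]]] := sol2 _ Ww2.
  exists (row_mx Z1 Z2), (row_mx c1 c2); split.
    by rewrite sylv_block !coef_act0 !subr0 SZ1 SZ2 mul_mx_row.
  by rewrite mul_row_block !mulmx0 addr0 add0r Ze1 Ze2.
Qed.

Lemma reaches_add q (W1 W2 : set 'M[F]_(d, q)) :
  reaches W1 -> reaches W2 ->
  reaches [set w1 + w2 | w1 in W1 & w2 in W2]%classic.
Proof.
move=> W1r W2r.
have := reaches_mulr (col_mx 1%:M 1%:M) (reaches_row_mx W1r W2r).
apply: reaches_subset => _ [w1 Ww1 [w2 Ww2 <-]]; exists (row_mx w1 w2).
  by exists w1 => //; exists w2.
by rewrite mul_row_col !mulmx1.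
Qed.

Lemma reaches_scale q (W : set 'M[F]_(d, q)) :
  reaches W -> reaches [set u | exists a, exists2 w, W w & u = a *: w]%classic.
Proof.
move=> [m [S [e [inj0 scale sol]]]]; exists m, S, e; split=> //.
move=> _ [a [w /sol[Z [c [SZ Ze]]] ->]]; exists (a *: Z), (a *: c).
by rewrite linearZ /= SZ -scalemxAr -scalemxAl Ze.
Qed.

(** One tuple has to serve the whole span, so the models of the generators are put in direct sum and
    their scaled readouts added. *)
Lemma reaches_span q (s : seq 'M[F]_(d, q)) :
    (forall v, v \in s -> reaches [set v]%classic) ->
  reaches [set u | u \in << s >>%VS]%classic.
Proof.
elim: s => [_ | v s IHs vsr].
  exists 0%N, (fun=> 0), 0; split=> [Z _ | rho _ | u].
  - exact: thinmx0.
  - by exists 0; split=> [||j]; rewrite ?trmx0 ?mulmx0 ?scaler0.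
  - rewrite /= span_nil memv0 => /eqP ->; exists 0, 0.
    by rewrite linear0 !mulmx0.
have sr : reaches [set u | u \in << s >>%VS]%classic.
  by apply: IHs => w ws; apply: vsr; rewrite inE ws orbT.
have := reaches_add (reaches_scale (vsr v (mem_head _ _))) sr.
apply: reaches_subset => u /=; rewrite span_cons => /memv_addP[x /vlineP[a ->]].
move=> [w sw ->]; exists (a *: v); first by exists a, v.
by exists w.
Qed.

Hypothesis Wspan : forall v : 'cV[F]_d, exists s : seq (seq 'I_g * 'cV[F]_l),
  v \in <<[seq (\big[mulmx/1%:M]_(i <- p.1) (J *m A i))
                  *m J *m C *m p.2 | p <- s]>>%VS.

Lemma reaches_setT q : reaches [set: 'M[F]_(d, q)]%classic.
Proof.
have word (w : seq 'I_g) (h : 'cV[F]_l) :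
    reaches [set \big[mulmx/1%:M]_(i <- w) (J *m A i) *m J *m C *m h]%classic.
  elim: w => [|j w IHw]; first by rewrite big_nil mul1mx; exact: reaches_base.
  apply: reaches_subset (reaches_mulJA j IHw) => _ ->; rewrite big_cons.
  exists (\big[mulmx/1%:M]_(i <- w) (J *m A i) *m J *m C *m h) => //.
  by rewrite !mulmxA.
have vec1 (v : 'cV[F]_d) : reaches [set v]%classic.
  have [s] := Wspan v; set t := [seq _ | p <- s] => vt.
  apply: (@reaches_subset _ [set u | u \in << t >>%VS]%classic).
    by move=> _ ->.
  by apply: reaches_span => u /mapP[p _ ->]; exact: word.
(* The words supplied by minimality depend on the vector; a finite basis brings all vectors under a
   single model. *)
have vecT : reaches [set: 'cV[F]_d]%classic.
  pose t : seq 'cV[F]_d := vbasis fullv.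
  apply: (@reaches_subset _
    [set u | u \in << t >>%VS]%classic); last first.
    by apply: reaches_span => v _; exact: vec1.
  by move=> u _ /=; rewrite (span_basis (vbasisP _)) memvf.
elim: q => [|q IHq].
  have := reaches_mulr (0 : 'M[F]_(1, 0)) vecT.
  apply: reaches_subset => u _; exists 0 => //.
  by rewrite mulmx0 (thinmx0 u).
apply: reaches_subset (reaches_row_mx vecT IHq) => u _.
exists (lsubmx (u : 'M[F]_(d, 1 + q))) => //.
by exists (rsubmx (u : 'M[F]_(d, 1 + q))) => //; rewrite hsubmxK.
Qed.

End Reachability.

(** [K] is fixed before [delta], because the radius in the definition of a well hidden singularity
    depends on [K]. Interpolation holds for the nilpotent model and survives a small perturbation,
    which is conjugate to the symmetric tuple. *)
Lemma full_reach_small (R : realFieldType) g d l (J : 'M[R]_d)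
    (A : 'I_g -> 'M[R]_d) (C : 'M[R]_(d, l)) q :
    J *m J = 1%:M -> reaches J A C [set: 'M[R]_(d, q)]%classic ->
  exists m (K : 'I_g -> 'M[R]_m) (e : 'M[R]_(m, q)),
    (forall j, (K j)^T = K j) /\
    forall delta : R, 0 < delta -> exists rho,
      [/\ 0 < rho, rho < delta,
          bijective (@sylv _ _ d m J A (fun j => rho *: K j)) &
          forall U : 'M[R]_(d, q), exists Z c,
            sylv J A (fun j => rho *: K j) Z = C *m c /\ Z *m e = U].
Proof.
move=> JJ [m [S [e [inj0 scale sol]]]].
pose K j := S j + (S j)^T; exists m, K, e; split=> [j | delta delta0].
  by rewrite /K linearD /= trmxK addrC.
have [sZ sZP] := choice (fun u => sol u I).
have [sc scP] := choice sZP; rewrite {sZP} in scP.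
(* The chosen solutions [sZ] and [sc] need not be linear; [lift] keeps their values on the unit
   matrices and extends linearly. *)
pose lift p (f : 'M[R]_(d, q) -> 'M[R]_(p, m)) (b : 'M[R]_(d, q)) :=
  \sum_i \sum_k b i k *: f (delta_mx i k).
have lift_lin p (f : 'M[R]_(d, q) -> 'M[R]_(p, m)) : linear (lift p f).
  move=> a b b'; rewrite scaler_sumr -big_split; apply: eq_bigr => i _ /=.
  rewrite scaler_sumr -big_split; apply: eq_bigr => k _ /=.
  by rewrite !mxE scalerDl scalerA.
have liftP b : sylv J A S (lift d sZ b) = C *m lift l sc b /\
    lift d sZ b *m e = b.
  split.
    rewrite /lift linear_sum mulmx_sumr; apply: eq_bigr => i _.
    rewrite linear_sum mulmx_sumr; apply: eq_bigr => k _.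
    by rewrite linearZ -scalemxAr /= (scP _).1.
  rewrite [RHS]matrix_sum_delta mulmx_suml; apply: eq_bigr => i _.
  rewrite mulmx_suml; apply: eq_bigr => k _.
  by rewrite -scalemxAl (scP _).2.
(* The extra unknown [b = rsubmx Y] parametrises the right-hand side and balances the [q] readout
   columns, so the bordered operator is square. *)
pose f0 (Y : 'M[R]_(d, m + q)) : 'M[R]_(d, m + q) :=
  row_mx (sylv J A S (lsubmx Y) - C *m lift l sc (rsubmx Y)) (lsubmx Y *m e).
pose f1 (Y : 'M[R]_(d, m + q)) : 'M[R]_(d, m + q) :=
  row_mx (- coef_act A (fun j => (S j)^T) (lsubmx Y)) 0.
have f0_lin : linear f0.
  move=> a Y Z; rewrite /f0 scale_row_mx add_row_mx.
  rewrite (linearP lsubmx) (linearP rsubmx) lift_lin linearP /=.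
  rewrite mulmxDl scalemxAl mulmxDr -scalemxAr [in RHS]scalerBr opprD.
  by congr row_mx; rewrite addrACA.
have f1_lin : linear f1.
  move=> a Y Z; rewrite /f1 scale_row_mx add_row_mx.
  by rewrite (linearP lsubmx) linearP /= opprD scalerN scaler0 addr0.
pose F0 : {linear _ -> _} :=
  HB.pack f0 (GRing.isLinear.Build _ _ _ _ f0 f0_lin).
pose F1 : {linear _ -> _} :=
  HB.pack f1 (GRing.isLinear.Build _ _ _ _ f1 f1_lin).
(* At t = 0 the unknown pair (Z, b) solves the nilpotent model; invertibility
   of the bordered operator is open in t, and t = rho^2 is the symmetric one. *)
have [Y|p2 [p20 p2P]] := @linear_pencil_bij _ _ _ F0 F1 0.
  rewrite scale0r addr0 /= /f0 -[0]row_mx0 => /eq_row_mx[/eqP].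
  (* Injectivity at [S] identifies the first block of [Y] with [lift d sZ b], whose readout is [b];
     a zero readout therefore kills both blocks. *)
  have [SY eY] := liftP (rsubmx Y).
  rewrite -SY -linearB => /eqP/inj0/eqP; rewrite subr_eq0 => /eqP YE.
  rewrite YE eY => Y2; rewrite -[Y]hsubmxK YE Y2 /lift big1 ?row_mx0 // => i _.
  by rewrite big1 // => k _; rewrite mxE scale0r.
have [Y|p1 [p10 p1P]] := @sylv_pencil_bij _ _ _ m J A 0 (fun=> 0) K.
  rewrite (@eq_sylv _ _ _ _ _ _ _ (fun=> 0)) ?sylv0; first exact: invol_inj.
  by move=> j; rewrite scale0r addr0.
(* [p1] is to be evaluated at [rho] and [p2] at [rho ^+ 2]; neither vanishes at 0. *)
have p_neq0 : p1 * (p2 \Po 'X^2) != 0.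
  apply: contraNneq (mulf_neq0 p10 p20) => /(congr1 (horner^~ 0)).
  by rewrite hornerM horner_comp hornerXn expr0n horner0 => ->.
have [rho [rho0 rhod]] := exists_small_nonroot p_neq0 delta0.
rewrite hornerM horner_comp hornerXn mulf_eq0 negb_or => /andP[/p1P bij1].
move=> /p2P[G _ GK]; exists rho; split=> // [|U].
  apply: (eq_bij bij1) => Y; apply: eq_sylv => j; exact: add0r.
have [D [Ds De SD]] := scale _ (lt0r_neq0 rho0).
have DSt j : rho *: (D *m (S j)^T) = rho ^+ 2 *: ((S j)^T *m D).
  have := congr1 trmx (SD j); rewrite trmx_mul linearZ /= trmx_mul Ds => ->.
  by rewrite scalerA expr2.
have := GK (row_mx 0 U); set Y := G _.
rewrite /= /f0 /f1 scale_row_mx add_row_mx scaler0 addr0.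
(* Right multiplication by [D] carries a solution at [S_j + rho^2 S_j^T] to one at [rho K_j], and
   [D e = e] preserves the readout. *)
move=> /eq_row_mx[Y1 Y2]; exists (lsubmx Y *m D), (lift l sc (rsubmx Y) *m D).
split; last by rewrite -mulmxA De.
rewrite [RHS]mulmxA; move/eqP: Y1; rewrite addrAC subr_eq0 => /eqP <-.
rewrite /sylv mulmxDl mulmxBl mulmxA -addrA; congr (_ + _).
rewrite -scalemxAl mulNmx scalerN -opprD; congr (- _).
rewrite !coef_act_mulr coef_act_mull -coef_actZr -coef_actDr.
apply: eq_coef_act => j.
by rewrite -scalemxAr mulmxDr scalerDr -SD DSt.
Qed.

(** * Vectorisation in the index order of the Kronecker product *)

Definition mxcolvec (R : Type) m n (Y : 'M[R]_(m, n)) : 'cV[R]_(m * n) :=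
  \col_k Y (mxtens_unindex k).1 (mxtens_unindex k).2.

Lemma mxcolvecE (R : Type) m n (Y : 'M[R]_(m, n)) i j k :
  mxcolvec Y (mxtens_index (i, j)) k = Y i j.
Proof. by rewrite mxE mxtens_indexK. Qed.

Lemma mxcolvec_inj (R : Type) m n : injective (@mxcolvec R m n).
Proof.
by move=> Y Z YZ; apply/matrixP => i j; rewrite -(mxcolvecE Y _ _ 0) YZ mxcolvecE.
Qed.

Lemma mxcolvec_surj (R : Type) m n (v : 'cV[R]_(m * n)) :
  exists Y, v = mxcolvec Y.
Proof.
exists (\matrix_(i, j) v (mxtens_index (i, j)) 0).
apply/colP => k; rewrite !mxE /=; congr (v _ _).
by rewrite -[LHS]mxtens_unindexK; congr mxtens_index.
Qed.

Lemma mxcolvec0 (R : nmodType) m n : mxcolvec (0 : 'M[R]_(m, n)) = 0.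
Proof. by apply/matrixP => k z; rewrite !mxE. Qed.

Lemma mxcolvecD (R : nmodType) m n (Y Z : 'M[R]_(m, n)) :
  mxcolvec (Y + Z) = mxcolvec Y + mxcolvec Z.
Proof. by apply/matrixP => k z; rewrite !mxE. Qed.

Lemma mxcolvecB (R : zmodType) m n (Y Z : 'M[R]_(m, n)) :
  mxcolvec (Y - Z) = mxcolvec Y - mxcolvec Z.
Proof. by apply/matrixP => k z; rewrite !mxE. Qed.

Lemma mxcolvec_sum (R : nmodType) m n I (s : seq I) (Y : I -> 'M[R]_(m, n)) :
  mxcolvec (\sum_(i <- s) Y i) = \sum_(i <- s) mxcolvec (Y i).
Proof.
by apply: (big_morph _ (@mxcolvecD R m n) (@mxcolvec0 R m n)).
Qed.

Lemma tensmx_colvec (R : comNzRingType) p m q n (A : 'M[R]_(p, m))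
    (B : 'M[R]_(q, n)) (Y : 'M[R]_(m, n)) :
  (A *t B) *m mxcolvec Y = mxcolvec (A *m Y *m B^T).
Proof.
apply/matrixP => k z; case: (mxtens_indexP k) => a b.
rewrite mxcolvecE !mxE.
rewrite (reindex_onto (@mxtens_index m n) (@mxtens_unindex m n)); last first.
  by move=> k' _; rewrite mxtens_unindexK.
rewrite (eq_bigl xpredT) => [|ij]; last by rewrite mxtens_indexK eqxx.
transitivity (\sum_i \sum_j A a i * B b j * Y i j).
  rewrite pair_bigA; apply: eq_bigr => -[i j] _ /=.
  by rewrite tensmxE mxcolvecE.
rewrite exchange_big; apply: eq_bigr => j _ /=.
rewrite !mxE mulr_suml; apply: eq_bigr => i _.
by rewrite mulrAC.
Qed.

(** * Values of the realization and the limit condition *)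

Section Realization.
Context {R : realType} {g d l : nat}.
Variable r : sym_descriptor R g d l.

Lemma sd_pencil_colvec n (X : 'I_g -> 'M[R]_n) (Y : 'M[R]_(d, n)) :
  sym_tuple X ->
  sd_pencil r X *m mxcolvec Y = mxcolvec (sylv (sd_J r) (sd_A r) X Y).
Proof.
move=> Xs; rewrite mulmxBl mulmx_suml mxcolvecB mxcolvec_sum.
rewrite tensmx_colvec trmx1 mulmx1; congr (_ - _).
by apply: eq_bigr => j _; rewrite tensmx_colvec Xs.
Qed.

Lemma sd_pencil_unit n (X : 'I_g -> 'M[R]_n) : sym_tuple X ->
    (forall Y : 'M[R]_(d, n), sylv (sd_J r) (sd_A r) X Y = 0 -> Y = 0) ->
  sd_pencil r X \in unitmx.
Proof.
move=> Xs inj0; apply: unitmx_inj => v; have [Y ->] := mxcolvec_surj v.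
by rewrite sd_pencil_colvec // -mxcolvec0 => /mxcolvec_inj/inj0 ->.
Qed.

(** An explicit preimage [Y] of [C c] replaces the inverse of the pencil in every later
    computation. *)
Lemma sd_eval_colvec n (X : 'I_g -> 'M[R]_n) (Y : 'M[R]_(d, n)) c :
  invertibility_set r X -> sylv (sd_J r) (sd_A r) X Y = sd_C r *m c ->
  sd_eval r X *m mxcolvec c = mxcolvec (sd_D r *m c + (sd_C r)^T *m Y).
Proof.
move=> [Xs Xu] XY; rewrite mulmxDl mxcolvecD -!mulmxA !tensmx_colvec.
rewrite !trmx1 !mulmx1 -XY -sd_pencil_colvec // mulKmx //.
by rewrite tensmx_colvec trmx1 mulmx1.
Qed.

(** The filter of uniform entrywise boxes converges to [chi] in each component, hence in the product
    topology. *)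
Lemma nbhs_ptws_mx n (chi : 'I_g -> 'M[R]_n) (P : set ('I_g -> 'M[R]_n)) :
  nbhs (chi : {ptws 'I_g -> 'M[R]_n}) P ->
  exists2 delta : R, 0 < delta & forall X : 'I_g -> 'M[R]_n,
    (forall j a b, `|X j a b - chi j a b| < delta) -> P X.
Proof.
pose close (delta : R) : set ('I_g -> 'M[R]_n) :=
  [set X | forall j a b, `|X j a b - chi j a b| < delta]%classic.
pose G := filter_from [set delta : R | 0 < delta]%classic close.
have GF : Filter G.
  apply: filter_from_filter; first by exists 1 => /=.
  move=> x y /= x0 y0; exists (Num.min x y); first by rewrite lt_min x0.
  move=> X XP; split=> j a b; have := XP j a b; rewrite lt_min;
    by case/andP.
suff Gchi : (G --> (chi : {ptws 'I_g -> 'M[R]_n}))%classic.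
  by move=> /Gchi [delta delta0 deltaP]; exists delta => // X; exact: deltaP.
apply/cvg_sup => j; rewrite cvg_image; last first.
  by rewrite eqEsubset; split=> v // _; exists (fun=> v).
move=> W; rewrite nbhs_ballP => -[delta /= delta0 deltaW].
exists ((fun X => X j) @^-1` W)%classic; last first.
  by rewrite image_preimage // eqEsubset; split=> v // _; exists (fun=> v).
exists delta => // X XP; apply: deltaW; split=> // a b.
by rewrite /ball /= distrC.
Qed.

Lemma hidden_singularity_cauchy n (chi : 'I_g -> 'M[R]_n) (eta : R) :
  hidden_singularity r chi -> 0 < eta ->
  exists2 delta : R, 0 < delta & forall X X' : 'I_g -> 'M[R]_n,
    invertibility_set r X -> invertibility_set r X' ->
    (forall j a b, `|X j a b - chi j a b| < delta) ->
    (forall j a b, `|X' j a b - chi j a b| < delta) ->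
    forall i k, `|(sd_eval r X - sd_eval r X') i k| < eta.
Proof.
move=> [_ _ [L cvgL]] eta0; have e20 : 0 < eta / 2 by rewrite divr_gt0.
have /nbhs_ptws_mx[delta delta0 deltaP] := cvgL _ (nbhsx_ballx L _ e20).
exists delta => // X X' Xi X'i Xc X'c i k.
have [_ /(_ i k)] := deltaP _ Xc Xi; have [_ /(_ i k)] := deltaP _ X'c X'i.
rewrite /ball /= => b' b; rewrite mxE [X in _ + X]mxE.
have -> : sd_eval r X i k - sd_eval r X' i k =
  - (L i k - sd_eval r X i k) + (L i k - sd_eval r X' i k) by ring.
by rewrite (le_lt_trans (ler_normD _ _)) // normrN [eta]splitr ltrD.
Qed.

End Realization.

(** * Trace positivity and entry bounds *)

Lemma mxtrace_sqr_eq0 (R : realDomainType) m n (M : 'M[R]_(m, n)) :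
  \tr (M^T *m M) = 0 -> M = 0.
Proof.
move=> /eqP trM; apply/matrixP => i k; rewrite [RHS]mxE; apply/eqP.
rewrite -sqrf_eq0; move: trM; rewrite /mxtrace.
have sqE k' : (M^T *m M) k' k' = \sum_i' M i' k' ^+ 2.
  by rewrite mxE; apply: eq_bigr => i' _; rewrite mxE expr2.
rewrite psumr_eq0 => [/allP/(_ k (mem_index_enum k))|k' _]; last first.
  by rewrite sqE sumr_ge0 // => i' _; rewrite sqr_ge0.
rewrite sqE psumr_eq0 => [/allP/(_ i (mem_index_enum i))|i' _] //.
by rewrite sqr_ge0.
Qed.

Lemma entries_bounded (R : realDomainType) g m n (X : 'I_g -> 'M[R]_(m, n)) :
  exists2 M, 0 < M & forall j a b, `|X j a b| <= M.
Proof.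
exists (\big[Num.max/1]_(t : 'I_g * 'I_m * 'I_n) `|X t.1.1 t.1.2 t.2|).
  by rewrite (lt_le_trans ltr01) // bigmax_ge_id.
by move=> j a b; exact: (le_bigmax _ (fun t => `|X t.1.1 t.1.2 t.2|) (j, a, b)).
Qed.

(** * Coupling the singularity to a regular tuple *)

Section Coupling.
Context {R : realType} {g d l n m : nat}.
Variables (J : 'M[R]_d) (A : 'I_g -> 'M[R]_d) (C : 'M[R]_(d, l)).
Variables (chi : 'I_g -> 'M[R]_n) (K : 'I_g -> 'M[R]_m).
Variable H : 'I_g -> 'M[R]_(m, n).

Definition coupled_tuple (s eps : R) : 'I_g -> 'M[R]_(n + m) := fun j =>
  block_mx ((1 - eps) *: chi j) (s *: (H j)^T) (s *: H j) (K j).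

Lemma coupled_tuple_close (delta : R) : 0 < delta ->
  exists2 s0, 0 < s0 & forall s eps, 0 <= s -> s < s0 -> 0 < eps -> eps < s0 ->
    forall j a b, `|coupled_tuple s eps j a b - dsum_tuple chi K j a b| < delta.
Proof.
move=> delta0; have [M M0 chiM] := entries_bounded chi.
have [N N0 HN] := entries_bounded H.
exists (delta / (M + N)) => [|s eps s_ge0 ss0 eps0 epss0 j a b].
  by rewrite divr_gt0 // addr_gt0.
have small t x : 0 <= t -> t < delta / (M + N) -> `|x| <= M + N ->
    `|t * x| < delta.
  move=> t0 tlt xle; rewrite normrM (ger0_norm t0).
  rewrite (le_lt_trans (ler_wpM2l t0 xle)) //.
  by rewrite -ltr_pdivlMr // addr_gt0.
have chiMN a' b' : `|- chi j a' b'| <= M + N.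
  by rewrite normrN (le_trans (chiM _ _ _)) // lerDl ltW.
have HMN a' b' : `|H j a' b'| <= M + N.
  by rewrite (le_trans (HN _ _ _)) // lerDr ltW.
rewrite /coupled_tuple /dsum_tuple.
case: (split_ordP a) => a' ->; case: (split_ordP b) => b' ->.
- rewrite !block_mxEul mxE.
  have -> : (1 - eps) * chi j a' b' - chi j a' b' = eps * - chi j a' b' by ring.
  by apply: small => //; exact: ltW.
- by rewrite !block_mxEur !mxE subr0; apply: small.
- by rewrite !block_mxEdl !mxE subr0; apply: small.
- by rewrite !block_mxEdr subrr normr0.
Qed.

Hypothesis Jinvol : J *m J = 1%:M.
Hypothesis Kinj : forall Y : 'M[R]_(d, m), sylv J A K Y = 0 -> Y = 0.

(** At [eps = 1] the [chi] block disappears, and at [s = 0] the operator then splits into [J] and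
    the injective one of [K]. So [s] is chosen first along [eps = 1], then [eps] as a common nonroot
    for [s] and for 0. *)
Lemma coupled_tuple_regular (s0 : R) : 0 < s0 ->
  exists s eps, [/\ 0 < s, s < s0, 0 < eps, eps < s ^+ 2 & eps < s0] /\
    (forall Y : 'M[R]_(d, n + m), sylv J A (coupled_tuple s eps) Y = 0 -> Y = 0) /\
    (forall Y : 'M[R]_(d, n + m), sylv J A (coupled_tuple 0 eps) Y = 0 -> Y = 0).
Proof.
move=> s00.
pose D0 j : 'M[R]_(n + m) := block_mx 0 0 0 (K j).
pose D1 j : 'M[R]_(n + m) := block_mx 0 (H j)^T (H j) 0.
pose D2 j : 'M[R]_(n + m) := block_mx (- chi j) 0 0 0.
have coupled1 s : coupled_tuple s 1 =1 (fun j => D0 j + s *: D1 j).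
  move=> j; rewrite /coupled_tuple /D0 /D1 subrr !scale0r scale_block_mx.
  by rewrite scaler0 add_block_mx !add0r scaler0 addr0.
have coupledE s eps : coupled_tuple s eps =1
    (fun j => coupled_tuple s 0 j + eps *: D2 j).
  move=> j; rewrite /coupled_tuple /D2 scale_block_mx add_block_mx.
  by rewrite !scaler0 !addr0 subr0 scale1r scalerN scalerBl scale1r.
have inj01 (Y : 'M[R]_(d, n + m)) : sylv J A (coupled_tuple 0 1) Y = 0 -> Y = 0.
  rewrite (eq_sylv _ _ _ (coupled1 0)).
  rewrite (@eq_sylv _ _ _ _ _ _ _ D0) => [|j]; last by rewrite scale0r addr0.
  rewrite -[Y]hsubmxK sylv_block !coef_act0 !subr0 sylv0.
  rewrite -[0 in X in X -> _]row_mx0 => /eq_row_mx[/(invol_inj Jinvol) -> /Kinj ->].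
  by rewrite row_mx0.
have [Y|p1 [p10 p1P]] := @sylv_pencil_bij _ _ d _ J A 0 D0 D1.
  by rewrite -(eq_sylv _ _ _ (coupled1 0)); exact: inj01.
have p1_neq0 : p1 != 0 by apply: contraNneq p10 => ->; rewrite horner0.
(* Keeping [s] below 1 as well yields [eps < s^2 < s < s0]. *)
have min0 : 0 < Num.min 1 s0 by rewrite lt_min ltr01.
have [s [s_gt0]] := exists_small_nonroot p1_neq0 min0.
rewrite lt_min => /andP[s1 ss0] /p1P/bij_inj sinj.
have p_ex t : (forall Y : 'M[R]_(d, n + m),
    sylv J A (coupled_tuple t 1) Y = 0 -> Y = 0) ->
    exists p : {poly R}, p != 0 /\ forall eps, p.[eps] != 0 ->
      forall Y : 'M[R]_(d, n + m), sylv J A (coupled_tuple t eps) Y = 0 -> Y = 0.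
  move=> inj1; have [Y|p [p0 pP]] :=
      @sylv_pencil_bij _ _ d _ J A 1 (coupled_tuple t 0) D2.
    by rewrite -(eq_sylv _ _ _ (coupledE t 1)); exact: inj1.
  exists p; split; first by apply: contraNneq p0 => ->; rewrite horner0.
  move=> eps /pP/bij_inj einj Y; rewrite (eq_sylv _ _ _ (coupledE t eps)) => Y0.
  by apply: einj; rewrite Y0 linear0.
have [p2 [p2_neq0 p2P]] := p_ex 0 inj01.
have [Y|p3 [p3_neq0 p3P]] := p_ex s.
  rewrite (eq_sylv _ _ _ (coupled1 s)) => Y0.
  by apply: sinj; rewrite Y0 linear0.
have [eps [eps0 epss]] :=
  exists_small_nonroot (mulf_neq0 p2_neq0 p3_neq0) (exprn_gt0 2 s_gt0).
rewrite hornerM mulf_eq0 negb_or => /andP[/p2P inj2 /p3P inj3].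
exists s, eps; split=> //; split=> //.
by rewrite (lt_trans epss) // (lt_trans _ ss0) // expr2 gtr_pMr.
Qed.

(** Shrinking [chi] leaves the defect [(eps / s) sum_j A_j V chi_j] in the first block; the weight
    [eps / s ^+ 2] on [Z1] is what cancels it after coupling by [s]. In the second block [s] and
    [s^-1] cancel, and [Z0] absorbs the remaining term. *)
Lemma sylv_coupled (V : 'M[R]_(d, n)) (Z0 Z1 : 'M[R]_(d, m)) c0 c1 s eps :
    s != 0 -> sylv J A chi V = 0 ->
    (forall j, Z0 *m H j = 0) -> (forall j, Z1 *m H j = V *m chi j) ->
    sylv J A K Z0 = coef_act A (fun j => (H j)^T) V + C *m c0 ->
    sylv J A K Z1 = C *m c1 ->
  sylv J A (coupled_tuple s eps)
    (row_mx (s^-1 *: V) (Z0 + (eps / s ^+ 2) *: Z1)) =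
  row_mx 0 (C *m (c0 + (eps / s ^+ 2) *: c1)).
Proof.
move=> s0 /eqP; rewrite subr_eq0 => /eqP JV Z0H Z1H KZ0 KZ1.
have HZ0 : coef_act A H Z0 = 0.
  by rewrite /coef_act big1 // => j _; rewrite -mulmxA Z0H mulmx0.
have HZ1 : coef_act A H Z1 = coef_act A chi V.
  by apply: eq_bigr => j _; rewrite -!mulmxA Z1H.
have HZ : coef_act A H (Z0 + (eps / s ^+ 2) *: Z1) =
    (eps / s ^+ 2) *: coef_act A chi V.
  by rewrite linearD linearZ /= HZ0 HZ1 add0r.
rewrite sylv_block; congr row_mx.
  rewrite linearZ /= /sylv !coef_actZr HZ JV.
  rewrite scalerBl scale1r subKr !scalerA -scalerBl.
  suff -> : s^-1 * eps - s * (eps / s ^+ 2) = 0 by rewrite scale0r.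
  by field.
rewrite linearD linearZ /= KZ0 KZ1 coef_actZr [X in s *: X]linearZ /= scalerA.
by rewrite mulfV // scale1r mulmxDr -scalemxAr addrAC [X in X - _]addrC addrK.
Qed.

(** Pair the equation of [W] with a [Z] such that [Z H_j = A_j V]. One side is the sum of the
    squared norms of the [A_j V]; by self-adjointness the other is the trace of [c^T C^T W]. *)
Lemma dual_obstruction (V : 'M[R]_(d, n)) (W : 'M[R]_(d, m)) :
    J^T = J -> (forall j, (A j)^T = A j) -> (forall j, (K j)^T = K j) ->
    sylv J A chi V = 0 -> V != 0 ->
    sylv J A K W = coef_act A (fun j => (H j)^T) V ->
    (forall U : 'I_g -> 'M[R]_(d, n), exists Z c,
       sylv J A K Z = C *m c /\ forall j, Z *m H j = U j) ->
  C^T *m W != 0.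
Proof.
move=> Js As Ks /eqP; rewrite subr_eq0 => /eqP JV V0 KW solv.
apply: contraNneq V0 => CW; apply/eqP/(invol_inj Jinvol); rewrite JV.
have [Z [c [KZ ZH]]] := solv (fun j => A j *m V).
have tr0 : \tr (Z^T *m sylv J A K W) = 0.
  by rewrite mxtrace_sylv // KZ trmx_mul -mulmxA CW mulmx0 linear0.
rewrite /coef_act big1 // => j _; suff -> : A j *m V = 0 by rewrite mul0mx.
apply: mxtrace_sqr_eq0; apply/eqP.
have sumE : \tr (Z^T *m sylv J A K W) =
    \sum_i \tr ((A i *m V)^T *m (A i *m V)).
  rewrite KW mulmx_sumr linear_sum; apply: eq_bigr => i _ /=.
  by rewrite mulmxA mxtrace_mulC -ZH trmx_mul ZH !mulmxA.
move: tr0; rewrite sumE => /eqP; rewrite psumr_eq0.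
  by move=> /allP/(_ j (mem_index_enum j)).
move=> i _; rewrite /mxtrace sumr_ge0 // => k _; rewrite mxE sumr_ge0 // => k' _.
by rewrite mxE -expr2 sqr_ge0.
Qed.

End Coupling.

(** * Contradiction with the existence of the limit *)

Theorem theorem1p4 (R : realType) (g d l : nat) (hg : (0 < g)%N)
    (r : sym_descriptor R g d l)
    (hmin : minimal r)
    (hpos : posdef (sd_D r + (sd_C r)^T *m sd_J r *m sd_C r)) :
  forall (n : nat) (chi : 'I_g -> 'M[R]_n),
    (0 < n)%N -> ~ well_hidden r chi.
Proof.
move=> n chi _ [hid hidK]; have [chis chiNinv _] := hid.
pose J := sd_J r; pose A := sd_A r; pose C := sd_C r.
have JJ : J *m J = 1%:M := sd_J_invol r.
have [V V0 chiV] : exists2 V : 'M[R]_(d, n), V != 0 & sylv J A chi V = 0.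
  apply: contrapT => noV; apply: chiNinv; split=> //.
  apply: sd_pencil_unit => // Y Y0; apply: contrapT => YN0; apply: noV.
  by exists Y => //; apply/eqP.
(* One readout of [g] blocks of [n] columns allows all the products [Z H_j] to be prescribed at
   once. *)
have [m [K [e [Ks smallK]]]] := full_reach_small JJ
  (reaches_setT JJ hmin (\sum_(j < g) n)).
pose H j : 'M[R]_(m, n) := submxrow e j.
have solvP rho : (forall U : 'M[R]_(d, \sum_(j < g) n), exists Z c,
      sylv J A (fun j => rho *: K j) Z = C *m c /\ Z *m e = U) ->
    forall U : 'I_g -> 'M[R]_(d, n), exists Z c,
      sylv J A (fun j => rho *: K j) Z = C *m c /\ forall j, Z *m H j = U j.
  move=> solv U; have [Z [c [KZ Ze]]] := solv (\mxrow_j U j).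
  by exists Z, c; split=> // j; rewrite mul_submxrow Ze mxrowK.
have m0 : (0 < m)%N.
  have [rho [_ _ _ /solvP solv]] := smallK 1 ltr01.
  have [Z [_ [_ ZH]]] := solv (fun=> V).
  rewrite lt0n; apply: contraNneq V0 => m0; rewrite -(ZH (Ordinal hg)).
  by move: Z {ZH} (H _); rewrite m0 => Z B; rewrite (thinmx0 Z) mul0mx.
have [rho0 rho0_gt0 hidrho] := hidK m K m0 Ks.
have [rho [rho_gt0 rholt bij /solvP solv]] := smallK _ rho0_gt0.
have {hidrho} hid' : hidden_singularity r (dsum_tuple chi (fun j => rho *: K j)).
  by apply: hidrho; rewrite gtr0_norm.
pose Kr j := rho *: K j.
have Krs j : (Kr j)^T = Kr j by rewrite linearZ /= Ks.
have Kinj (Y : 'M[R]_(d, m)) : sylv J A Kr Y = 0 -> Y = 0.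
  by move=> Y0; apply: (bij_inj bij); rewrite Y0 linear0.
have [G _ GK] := bij.
(* [W] is the response of the [K] block to [V] through the coupling; [C^T W] is the jump [T]. *)
pose W : 'M[R]_(d, m) := G (coef_act A (fun j => (H j)^T) V).
have KW : sylv J A Kr W = coef_act A (fun j => (H j)^T) V := GK _.
have CW0 := dual_obstruction JJ (sd_J_sym r) (@sd_A_sym _ _ _ _ r) Krs chiV V0
  KW solv.
have [Z0' [c0 [KZ0' Z0'H]]] := solv (fun j => - (W *m H j)).
have [Z1 [c1 [KZ1 Z1H]]] := solv (fun j => V *m chi j).
pose Z0 := W + Z0'.
have Z0H j : Z0 *m H j = 0 by rewrite mulmxDl Z0'H subrr.
have KZ0 : sylv J A Kr Z0 = coef_act A (fun j => (H j)^T) V + C *m c0.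
  by rewrite linearD /= KW KZ0'.
have [i [k CWik]] : exists i k, (C^T *m W) i k != 0.
  apply: contrapT => all0; case/eqP: CW0; apply/matrixP => i k.
  by rewrite [RHS]mxE; apply: contrapT => /eqP ik0; apply: all0; exists i, k.
have [M0 M00 c0M] := entries_bounded (fun _ : 'I_1 => c0).
have [M1 M10 c1M] := entries_bounded (fun _ : 'I_1 => c1).
(* [N] will bound the sum of the absolute entries of [c], uniformly in [s] and [eps] since
   [eps / s ^+ 2] is at most 1; thus [eta] can be fixed before them. *)
pose N : R := (M0 + M1) *+ (l * (n + m)).
have N0 : 0 <= N by rewrite mulrn_wge0 // addr_ge0 // ltW.
pose eta := `|(C^T *m W) i k| / (N + 1).
have eta0 : 0 < eta by rewrite divr_gt0 ?normr_gt0 // ltr_wpDl.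
have [delta delta0 cauchy] := hidden_singularity_cauchy hid' eta0.
have [s0 s00 close] := coupled_tuple_close chi Kr H delta0.
have [s [eps [[s_gt0 ss0 eps0 epss epss0] [inj inj']]]] :=
  coupled_tuple_regular chi H JJ Kinj s00.
have coupled_sym t : sym_tuple (coupled_tuple chi Kr H t eps).
  move=> j; rewrite /coupled_tuple tr_block_mx; congr block_mx.
  - by rewrite linearZ /= chis.
  - by rewrite linearZ.
  - by rewrite linearZ /= trmxK.
  - exact: Krs.
set X := coupled_tuple chi Kr H s eps in inj.
set X' := coupled_tuple chi Kr H 0 eps in inj'.
have Xinv : invertibility_set r X.
  by split; [exact: coupled_sym | apply: sd_pencil_unit; first exact: coupled_sym].
have X'inv : invertibility_set r X'.
  by split; [exact: coupled_sym | apply: sd_pencil_unit; first exact: coupled_sym].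
pose lam := eps / s ^+ 2.
pose c : 'M[R]_(l, n + m) := row_mx 0 (c0 + lam *: c1).
pose Z := Z0 + lam *: Z1.
have XY : sylv J A X (row_mx (s^-1 *: V) Z) = C *m c.
  by rewrite mul_mx_row mulmx0 (sylv_coupled _ (lt0r_neq0 s_gt0) chiV Z0H Z1H KZ0 KZ1).
(* Without coupling the term produced by [V] is absent, so its response [W] is removed. *)
have X'Y : sylv J A X' (row_mx 0 (Z - W)) = C *m c.
  rewrite sylv_block mul_mx_row mulmx0; congr row_mx.
    by rewrite linear0 coef_actZr scale0r subr0.
  rewrite coef_actZr scale0r subr0 linearB linearD linearZ /= KZ0 KZ1 KW.
  by rewrite mulmxDr -scalemxAr addrAC [X in X - _]addrC addrK.
have diffE : (sd_eval r X - sd_eval r X') *m mxcolvec c =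
    mxcolvec (row_mx (C^T *m (s^-1 *: V)) (C^T *m W)).
  rewrite mulmxBl (sd_eval_colvec Xinv XY) (sd_eval_colvec X'inv X'Y).
  rewrite -mxcolvecB opprD addrACA subrr add0r -mulmxBr opp_row_mx add_row_mx.
  by rewrite subr0 subKr mul_mx_row.
have lam01 : 0 <= lam <= 1.
  by rewrite divr_ge0 ?sqr_ge0 ?(ltW eps0) //= ler_pdivrMr ?exprn_gt0 // mul1r ltW.
have cM a b : `|c a b| <= M0 + M1.
  case: (split_ordP b) => b' ->; rewrite ?row_mxEl ?row_mxEr mxE.
    by rewrite normr0 addr_ge0 // ltW.
  rewrite mxE (le_trans (ler_normD _ _)) // lerD ?(c0M 0) // normrM.
  case/andP: lam01 => lam0 lam1; rewrite ger0_norm //.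
  by rewrite (le_trans _ (c1M 0 a b')) // ler_piMl.
(* The shift by [n] selects the second block; the first one carries the unbounded factor [s^-1]. *)
have := congr1 (fun v : 'cV_(l * (n + m)) =>
  v (mxtens_index (i, rshift n k)) 0) diffE.
rewrite mxcolvecE row_mxEr => CWE.
(* This bound is impossible: [eta * N] is [N / (N + 1)] times the positive left-hand side. *)
suff : `|(C^T *m W) i k| <= eta * N.
  rewrite /eta mulrAC ler_pdivlMr ?ltr_wpDl // ler_pM2l ?normr_gt0 //.
  by rewrite gerDl ler10.
rewrite -CWE mxE (le_trans (ler_norm_sum _ _ _)) //.
rewrite /N -[X in _ *+ X](card_ord (l * (n + m))) -sumr_const.
rewrite mulr_sumr; apply: ler_sum => t _; rewrite normrM ler_pM //.
  apply/ltW/cauchy => //; apply: close => //; exact: ltW.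
by rewrite mxE cM.
Qed.
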